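(* Let $G$ be a finite connected graph (with combinatorial weights and no magnetic potential) and let $d\in\mathbb{N}$. If $d$ is not in the spectrum of the combinatorial Laplacian of $G$, and if $G$ has less than $(d-1)(d+2)/2$ edges, then $G$ has no $d$-clique.
   Context: Graphs are finite; multiple edges and loops are allowed. Edges are counted without orientation (so the complete graph $K_d$ has $d(d-1)/2$ edges). For $d\in\mathbb{N}$, a $d$-clique of a graph $G=(V,E)$ is an induced subgraph $G[V_0]$ (vertex set $V_0\subset V$ and all edges of $G$ with both endpoints in $V_0$) that is isomorphic to the complete graph $K_d$ of order $d=|V_0|$. The combinatorial Laplacian is $(\Delta\varphi)(v)=\sum_{e}\bigl(\varphi(v)-\varphi(v_e)\bigr)$ for $\varphi\colon V\to\mathbb{C}$, where the sum runs over all edges $e$ incident with $v$ (with multiplicity) and $v_e$ is the other endpoint of $e$ (loops contribute $0$). *)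

(* Defs.v *)
From HB Require Import structures.
From mathcomp Require Import all_boot all_order all_algebra.
From mathcomp Require Import complex.
From mathcomp Require Import reals.

Set Implicit Arguments.
Unset Strict Implicit.
Unset Printing Implicit Defensive.

Import Order.TTheory GRing.Theory Num.Theory.

Local Open Scope ring_scope.
Local Open Scope complex_scope.

(* Finite multigraphs, loops allowed. Each unoriented edge is a single element
   of [edge]; the order of its two ends is arbitrary and nothing below depends
   on it. *)
Record graph := Graph {
  vertex : finType;
  edge : finType;
  src : edge -> vertex;
  tgt : edge -> vertex }.

(* A singleton exactly when [e] is a loop. *)
Definition ends (G : graph) (e : edge G) : {set vertex G} :=
  [set src e; tgt e].

Definition incident (G : graph) (e : edge G) (v : vertex G) : bool :=
  v \in ends e.

(* Only meaningful when [e] is incident with [v]; it is [v] when [e] is a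
   loop. *)
Definition other_end (G : graph) (e : edge G) (v : vertex G) : vertex G :=
  if src e == v then tgt e else src e.

Definition adjacent (G : graph) : rel (vertex G) :=
  fun u v => [exists e : edge G, ends e == [set u; v]].

Definition connected (G : graph) : Prop :=
  forall u v : vertex G, connect (@adjacent G) u v.

Definition isomorphic (G H : graph) : Prop :=
  exists (f : vertex G -> vertex H) (g : edge G -> edge H),
    [/\ bijective f, bijective g & forall e, ends (g e) = f @: ends e].

Section Induced.
Variables (G : graph) (V0 : {set vertex G}).

Definition ivertex : finType := {v : vertex G | v \in V0}.
Definition iedge : finType :=
  {e : edge G | (src e \in V0) && (tgt e \in V0)}.

Definition isrc (e : iedge) : ivertex :=
  exist _ (src (val e)) (proj1 (andP (valP e))).
Definition itgt (e : iedge) : ivertex :=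
  exist _ (tgt (val e)) (proj2 (andP (valP e))).

Definition induced : graph := Graph isrc itgt.
End Induced.

Definition complete (d : nat) : graph :=
  @Graph 'I_d {p : 'I_d * 'I_d | (p.1 < p.2)%N}
    (fun p => (val p).1) (fun p => (val p).2).

Definition is_clique (G : graph) (d : nat) (V0 : {set vertex G}) : Prop :=
  #|V0| = d /\ isomorphic (induced V0) (complete d).

Definition has_clique (G : graph) (d : nat) : Prop :=
  exists V0 : {set vertex G}, is_clique d V0.

Section Laplacian.
Variables (R : realType) (G : graph).

(* [R[i]^o] is [R[i]] as a vector space over itself, so that the functions form
   a [vectType] over [R[i]]. *)
Definition laplacian (phi : {ffun vertex G -> R[i]^o}) :
    {ffun vertex G -> R[i]^o} :=
  [ffun v => \sum_(e : edge G | incident e v) (phi v - phi (other_end e v))].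

Lemma laplacian_is_linear : linear laplacian.
Proof.
move=> a phi psi; apply/ffunP => v; rewrite !ffunE scaler_sumr -big_split /=.
by apply: eq_bigr => e _; rewrite !ffunE scalerBr opprD addrACA.
Qed.

HB.instance Definition _ :=
  GRing.isLinear.Build R[i] {ffun vertex G -> R[i]^o} {ffun vertex G -> R[i]^o}
    *:%R laplacian laplacian_is_linear.

(* The space is finite-dimensional, so the spectrum is the set of
   eigenvalues. *)
Definition spectrum : pred R[i] := passmx.leigenvalue (linfun laplacian).
End Laplacian.

(* Main.v *)
Require Import Defs.
From HB Require Import structures.
From mathcomp Require Import all_boot all_order all_algebra.
From mathcomp Require Import complex.
From mathcomp Require Import reals.
From mathcomp Require Import lra.

(** A [d]-clique on [V0] uses up [d (d - 1) / 2] edges, so the edge bound leaves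
    at most [d - 2] further edges, because
    [(d - 1) (d + 2) / 2 = d (d - 1) / 2 + (d - 1)].  As the clique is an
    induced subgraph, each of these has at most one end in [V0], hence at least
    two vertices [a] and [b] of [V0] have no neighbour outside the clique
    ([two_free_vertices]).  For such a free vertex [u] the indicator function
    of [u] is mapped by the Laplacian to [d] times itself minus the indicator of
    [V0] ([laplacian_indicator_free]).  The last term does not depend on [u], so
    the difference of the indicators of [a] and [b] is an eigenfunction for the
    eigenvalue [d].

    Cliques enter only through the edge multiplicities: an isomorphism with
    the complete graph says that inside [V0] there are no loops and exactly one
    edge between any two distinct vertices ([multiplicity_clique]). *)

Set Implicit Arguments.
Unset Strict Implicit.
Unset Printing Implicit Defensive.

Import Order.TTheory GRing.Theory Num.Theory.
Local Open Scope ring_scope.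
Local Open Scope complex_scope.

(** At [u = v] the loops at [u] are counted. *)
Definition multiplicity (G : graph) (u v : vertex G) : nat :=
  #|[set e : edge G | ends e == [set u; v]]|.

Lemma multiplicity_sym (G : graph) (u v : vertex G) :
  multiplicity u v = multiplicity v u.
Proof. by rewrite /multiplicity setUC. Qed.

Lemma set2_eqE (T : finType) (a b u v : T) :
  ([set a; b] == [set u; v]) =
  ((a == u) && (b == v)) || ((a == v) && (b == u)).
Proof.
apply/eqP/idP => [/setP E|/orP[] /andP[/eqP-> /eqP->] //]; last by rewrite setUC.
move: (E a) (E b) (E u) (E v); rewrite !inE !eqxx ?orbT /= {E}.
rewrite !(eq_sym u) !(eq_sym v).
by do 4!case: (_ == _).
Qed.

Lemma multiplicity_isomorphic (G H : graph) (f : vertex G -> vertex H)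
    (g : edge G -> edge H) :
  bijective f -> bijective g -> (forall e, ends (g e) = f @: ends e) ->
  forall u v, multiplicity (f u) (f v) = multiplicity u v.
Proof.
move=> bij_f bij_g ends_g u v; rewrite /multiplicity.
rewrite -(on_card_preimset (onW_bij _ bij_g)).
apply: eq_card => e; rewrite !inE ends_g -imset_set1 -(imset_set1 f v) -imsetU.
by rewrite (inj_eq (imset_inj (bij_inj bij_f))).
Qed.

Lemma ends_induced (G : graph) (V0 : {set vertex G}) (e : edge (induced V0)) :
  ends (val e) = val @: ends e.
Proof. by rewrite /ends imsetU !imset_set1. Qed.

Lemma multiplicity_induced (G : graph) (V0 : {set vertex G})
    (u v : vertex (induced V0)) :
  multiplicity (val u) (val v) = multiplicity u v.
Proof.
rewrite /multiplicity -(card_imset [set e | _ == _] (@val_inj _ _ (iedge V0))).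
apply: eq_card => e; rewrite inE.
apply/idP/imsetP => [ends_e|[e' + ->]].
  have inV0 : (src e \in V0) && (tgt e \in V0).
    move: ends_e; rewrite set2_eqE.
    by case/orP=> /andP[/eqP-> /eqP->]; rewrite !(valP u, valP v).
  exists (exist _ e inV0 : iedge V0) => //.
  rewrite inE -(inj_eq (imset_inj val_inj)) -ends_induced /=.
  by rewrite imsetU !imset_set1.
rewrite inE -(inj_eq (imset_inj val_inj)) -ends_induced.
by rewrite imsetU !imset_set1.
Qed.

Lemma multiplicity_complete (d : nat) (i j : vertex (complete d)) :
  multiplicity i j = (i != j).
Proof.
rewrite /multiplicity.
wlog le_ij : i j / (i <= j)%N.
  move=> IH; have [/IH//|/ltnW/IH IHji] := leqP i j.
  by rewrite setUC IHji eq_sym.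
have [eq_ij|neq_ij] := eqVneq i j.
  apply/eqP; rewrite cards_eq0 -subset0; apply/subsetP => -[[k l] /= lt_kl].
  rewrite inE set2_eqE eq_ij /=.
  by case/orP=> /andP[/eqP E /eqP F]; exfalso; move: lt_kl; rewrite E F ltnn.
have lt_ij : (i < j)%N by rewrite ltn_neqAle neq_ij.
apply/eqP/cards1P.
exists (exist (fun p : 'I_d * 'I_d => (p.1 < p.2)%N) (i, j) lt_ij).
apply/setP => -[[k l] /= lt_kl]; rewrite !inE set2_eqE
  -[RHS](inj_eq (@val_inj _ _ {p : 'I_d * 'I_d | (p.1 < p.2)%N})) /= xpair_eqE.
case: andP => //= _; apply/negP => /andP[/eqP E /eqP F].
by clear -E F lt_kl le_ij; move: lt_kl; rewrite E F ltnNge le_ij.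
Qed.

Lemma card_edge_complete (d : nat) : #|edge (complete d)| = 'C(d, 2).
Proof.
rewrite card_sig -sum1_card -bin2_sum big_mkord.
rewrite -(pair_big_dep xpredT (fun i j : 'I_d => (i < j)%N) (fun _ _ => 1%N)).
rewrite (exchange_big_dep xpredT) //=; apply: eq_bigr => j _.
by rewrite -(big_ord_widen _ (fun=> 1%N) (ltnW (ltn_ord j))) sum1_card card_ord.
Qed.

Section Clique.
Variables (G : graph) (d : nat) (V0 : {set vertex G}).
Hypothesis clique : is_clique d V0.

Lemma multiplicity_clique (u v : vertex G) :
  u \in V0 -> v \in V0 -> multiplicity u v = (u != v).
Proof.
move=> uV0 vV0; have [_ [f [g [bij_f bij_g ends_g]]]] := clique.
pose u' : ivertex V0 := exist _ u uV0; pose v' : ivertex V0 := exist _ v vV0.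
rewrite (multiplicity_induced (u' : vertex (induced V0)) v').
rewrite -(multiplicity_isomorphic bij_f bij_g ends_g) multiplicity_complete.
by rewrite (inj_eq (bij_inj bij_f)).
Qed.

Definition inner_edges : {set edge G} :=
  [set e | (src e \in V0) && (tgt e \in V0)].

Lemma card_inner_edges : #|inner_edges| = 'C(d, 2).
Proof.
have [_ [_ [g [_ bij_g _]]]] := clique.
by rewrite -card_edge_complete -(bij_eq_card bij_g) card_sig cardsE.
Qed.

(** At these vertices the Laplacian of [G] acts as that of the complete graph on
    [V0]. *)
Definition free_vertices : {set vertex G} :=
  [set v in V0 | [forall e, incident e v ==> (e \in inner_edges)]].

(** An edge outside the induced subgraph spoils at most one vertex of [V0]. *)
Lemma card_not_free : (#|V0 :\: free_vertices| <= #|~: inner_edges|)%N.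
Proof.
pose end_in e := if src e \in V0 then src e else tgt e : vertex G.
apply: leq_trans (leq_imset_card end_in _); apply: subset_leq_card.
apply/subsetP => v; rewrite !inE => /andP[+ vV0]; rewrite vV0 /=.
case/forallPn => e; rewrite negb_imply => /andP[ve out].
apply/imsetP; exists e; first by rewrite inE.
move: ve out; rewrite /incident /end_in !inE.
by case/orP=> /eqP <-; rewrite vV0 ?andbT //= => /negPf->.
Qed.

Lemma two_free_vertices :
  (#|edge G| + 2 <= 'C(d, 2) + d)%N -> (1 < #|free_vertices|)%N.
Proof.
move=> few; have [cardV0 _] := clique; have := card_not_free.
have := cardsC inner_edges; rewrite card_inner_edges => cardE.
have := cardsID free_vertices V0.
rewrite (setIidPr _) ?cardV0; last by apply/subsetP=> v; rewrite inE => /andP[].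
rewrite -cardE -addnA leq_add2l in few.
move=> card_d le_out; rewrite -(leq_add2r #|V0 :\: free_vertices|) card_d.
by apply: leq_trans few; rewrite addnC leq_add2r.
Qed.

Lemma multiplicity_free (u w : vertex G) :
  u \in free_vertices -> multiplicity u w = (w \in V0) && (u != w).
Proof.
rewrite inE => /andP[uV0 /forallP freeu].
case: (boolP (w \in V0)) => [wV0|wV0]; first exact: multiplicity_clique.
apply/eqP; rewrite cards_eq0 -subset0; apply/subsetP => e; rewrite inE => ends_e.
have := freeu e; rewrite /incident (eqP ends_e) !inE eqxx /=.
move: ends_e; rewrite set2_eqE.
by case/orP=> /andP[/eqP-> /eqP->]; rewrite (negPf wV0) ?andbF.
Qed.

End Clique.

Lemma other_endE (G : graph) (e : edge G) (v w : vertex G) :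
  incident e v && (other_end e v == w) = (ends e == [set v; w]).
Proof.
rewrite /incident /other_end set2_eqE !inE !(eq_sym v).
have [->|] := eqVneq (src e) v => /=; last by rewrite andbC.
case: (eqVneq (tgt e) w) => //= neq_w; apply/esym/negP => /andP[/eqP E /eqP F].
by rewrite F E eqxx in neq_w.
Qed.

Section Eigenvalue.
Variables (R : realType) (G : graph).
Implicit Types (phi : {ffun vertex G -> R[i]^o}).

(** Grouping the edges at [v] by their other end; loops contribute [0] on both
    sides. *)
Lemma laplacianE phi v :
  laplacian phi v = \sum_w (phi v - phi w) *+ multiplicity v w.
Proof.
rewrite ffunE (partition_big (fun e => other_end e v) xpredT) //=.
apply: eq_bigr => w _.
rewrite (eq_bigr (fun=> phi v - phi w)); last by move=> e /andP[_ /eqP->].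
rewrite sumr_const; congr (_ *+ _).
by apply: eq_card => e; rewrite inE -other_endE.
Qed.

Definition indicator (A : {set vertex G}) : {ffun vertex G -> R[i]^o} :=
  [ffun v => (v \in A)%:R].

Lemma mem_spectrum (a : R[i]) phi :
  laplacian phi = a *: phi -> phi != 0 -> a \in @spectrum R G.
Proof.
move=> eig; apply: contraTT => /negbNE/eqP ker0; rewrite negbK.
rewrite -memv0 -ker0 memv_ker add_lfunE opp_lfunE scale_lfunE id_lfunE.
by rewrite lfunE /= eig subrr.
Qed.

Variables (d : nat) (V0 : {set vertex G}).
Hypothesis clique : is_clique d V0.

(** The diagonal entry is [d - 1], the degree of [u]; the other entries of the
    column of [u] are [-1] on the clique and [0] outside. *)
Lemma laplacian_indicator_free (u : vertex G) :
  u \in free_vertices V0 ->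
  laplacian (indicator [set u]) = d%:R *: indicator [set u] - indicator V0.
Proof.
move=> freeu; have [cardV0 _] := clique.
have uV0 : u \in V0 by move: freeu; rewrite inE => /andP[].
apply/ffunP => v; rewrite laplacianE !ffunE !inE.
have [->|neq_vu] := eqVneq v u.
  rewrite uV0.
  transitivity (\sum_(w in V0 :\ u) (1 : R[i])).
    rewrite [RHS]big_mkcond; apply: eq_bigr => w _.
    rewrite !ffunE !inE (multiplicity_free clique _ freeu) eq_sym andbC.
    by case: eqVneq; case: (w \in V0); rewrite //= ?subrr ?subr0 ?mul0rn.
  rewrite sumr_const -cardV0 (cardsD1 u V0) uV0 /= natrD [_ *: _]mulr1.
  by rewrite addrC addKr.
rewrite (bigD1 u) //= big1 => [|w neq_wu].
  rewrite !ffunE inE eqxx multiplicity_sym (multiplicity_free clique _ freeu).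
  by rewrite eq_sym neq_vu andbT addr0 scaler0 !sub0r mulNrn.
by rewrite !ffunE inE (negPf neq_wu) subrr mul0rn.
Qed.

Lemma clique_eigenvalue :
  (1 < #|free_vertices V0|)%N -> (d%:R : R[i]) \in @spectrum R G.
Proof.
case/card_gt1P => a [b [freea freeb neq_ab]].
apply: (@mem_spectrum _ (indicator [set a] - indicator [set b])).
  rewrite linearB /= !laplacian_indicator_free // scalerBr.
  by rewrite opprB addrA subrK.
apply/eqP => /ffunP/(_ a); rewrite !ffunE !inE eqxx (negPf neq_ab) subr0.
by move/eqP; rewrite oner_eq0.
Qed.

End Eigenvalue.

(** The bound [(d - 1) (d + 2) / 2] is one less than [d (d - 1) / 2 + d]; moving
    the constants to the left avoids truncated subtraction when [d < 2]. *)
Lemma few_edges_nat (R : realType) (m d : nat) :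
  (m%:R : R) < (d%:R - 1) * (d%:R + 2) / 2 -> (m + 2 <= 'C(d, 2) + d)%N.
Proof.
case: d => [|d] lt_m; first by exfalso; have := ler0n R m; lra.
have bin2d : 'C(d.+1, 2)%:R * 2 = (d%:R + 1) * d%:R :> R.
  by rewrite -natrM -[2%N]/(2`!)%N bin_ffact ffactnS ffactn1 natrM natr1.
(* Hides the binomial coefficient, which [natrD] would split by Pascal's rule. *)
move: 'C(d.+1, 2) bin2d => b bin2d.
suff : ((m + 1)%:R : R) < (b + d.+1)%:R by rewrite ltr_nat addn1 addn2.
by move: lt_m; rewrite !natrD -[d.+1%:R]natr1; lra.
Qed.

Theorem corollary5p4 (R : realType) (G : graph) (d : nat)
    (Gconn : connected G)
    (d_spec : (d%:R : R[i]) \notin spectrum G)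
    (few_edges : (#|edge G|%:R : R) < (d%:R - 1) * (d%:R + 2) / 2) :
  ~ has_clique G d.
Proof.
case=> V0 clique; move/negP: d_spec; apply.
apply: (clique_eigenvalue R clique).
exact: (two_free_vertices clique (few_edges_nat few_edges)).
Qed.
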